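(* Let $L\subseteq\{1\}^*$ be a tally language. Let $\omega_L=\omega_1\omega_2\dots$ be the infinite binary word with $\omega_{2n-1}=1$ for all $n\ge1$ and $\omega_{2n}=1$ iff $1^n\in L$ (and $\omega_{2n}=0$ otherwise). Then $L\in\mathcal{R}(W_{1.5}^{\omega_L})$.
   Context: For an infinite binary word $\omega=\omega_1\omega_2\dots$, the memory model $W_{1.5}^{\omega}$ is the following marked graph: cells $1,2,3,\dots$, initial cell $1$; from each cell $n$ there is an edge $n\to n+1$ and an edge $n\to 1$ (to the initial cell); the edge $n\to n+1$ is marked $+$ and the edge $n\to1$ marked $-$ if $\omega_n=1$, and the marks are swapped (edge $n\to n+1$ marked $-$, edge $n\to1$ marked $+$) if $\omega_n=0$. An $h$-head automaton with auxiliary memory of a marked graph model $M$ (marks $G=\{+,-\}$) has a finite state set, input alphabet $\Sigma$ with endmarkers, a finite memory alphabet $\Delta$, a transition function mapping (state, the $h$ input symbols under its 2-way read-only heads, the symbol in the current memory cell) to (new state, a move in $\{-1,0,+1\}$ per head, and a mark in $G$ to follow from the current cell or ''stay''), an initial state and accepting states. It starts with heads at the leftmost input symbol and memory at the initial cell, runs deterministically for a fixed memory content $\mu\colon M\to\Delta$, and accepts $w$ iff for some $\mu$ it reaches an accepting state. $\mathcal{R}(M)$ is the class of languages recognized by such automata. *)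

(* Defs.v *)
From HB Require Import structures.
From mathcomp Require Import all_boot.
From mathcomp Require Import boolp.

Set Implicit Arguments.
Unset Strict Implicit.
Unset Printing Implicit Defensive.

Inductive mark := Plus | Minus.

(* [follow m g] is the end of the unique edge that leaves [m] with mark [g]. *)
Record marked_graph := MarkedGraph {
  cell : Type;
  cell_init : cell;
  follow : cell -> mark -> cell
}.

(* An infinite word w_1 w_2 ... is a function [nat -> bool] whose value at    *)
(* index [n >= 1] is w_n; the value at index 0 is never used.                 *)
Definition omega_word := nat -> bool.

(* The cells 1, 2, 3, ... are represented by 0, 1, 2, ...: [k : nat] stands   *)
(* for cell [k.+1].                                                           *)
Definition W15_follow (w : omega_word) (k : nat) (g : mark) : nat :=
  match w k.+1, g with
  | true, Plus | false, Minus => k.+1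
  | true, Minus | false, Plus => 0
  end.

Definition W15 (w : omega_word) : marked_graph :=
  {| cell := nat; cell_init := 0; follow := W15_follow w |}.

Inductive input_symbol (Sigma : Type) :=
  LeftEnd | Letter of Sigma | RightEnd.
Arguments LeftEnd {Sigma}.
Arguments RightEnd {Sigma}.

Inductive head_move := MoveLeft | MoveNone | MoveRight.

(* In the result of [delta], [Some g] means "follow the edge marked [g]" and  *)
(* [None] means "stay in the current memory cell".                            *)
Record automaton (h : nat) (Sigma : finType) := Automaton {
  state : finType;
  mem_symbol : finType;
  delta : state -> {ffun 'I_h -> input_symbol Sigma} -> mem_symbol ->
          state * {ffun 'I_h -> head_move} * option mark;
  state_init : state;
  accepting : {set state}
}.

Section Run.
Variables (M : marked_graph) (h : nat) (Sigma : finType).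
Variable A : automaton h Sigma.
Variable mu : cell M -> mem_symbol A.
Variable w : seq Sigma.

(* The tape holds [w] between endmarkers: position 0 is the left endmarker,   *)
(* positions 1 .. size w are the letters, (size w).+1 is the right endmarker. *)
Definition scan (p : nat) : input_symbol Sigma :=
  if p is i.+1 then
    if onth w i is Some a then Letter a else RightEnd
  else LeftEnd.

(* A head that would leave the tape stays on the endmarker.                   *)
Definition move_head (p : nat) (d : head_move) : nat :=
  match d with
  | MoveLeft => p.-1
  | MoveNone => p
  | MoveRight => minn p.+1 (size w).+1
  end.

Record config := Config {
  cfg_state : state A;
  cfg_heads : {ffun 'I_h -> nat};
  cfg_cell : cell M
}.

Definition config_init : config :=
  Config (state_init A) [ffun=> 0] (cell_init M).

Definition step (c : config) : config :=
  let: (q, d, g) :=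
    delta (cfg_state c) [ffun i => scan (cfg_heads c i)] (mu (cfg_cell c)) in
  Config q [ffun i => move_head (cfg_heads c i) (d i)]
    (if g is Some g' then follow (cfg_cell c) g' else cfg_cell c).

Definition accepts_with : Prop :=
  exists t : nat, cfg_state (iter t step config_init) \in accepting A.

End Run.

Definition language (Sigma : finType) := seq Sigma -> Prop.

Definition accepts (M : marked_graph) (h : nat) (Sigma : finType)
    (A : automaton h Sigma) (w : seq Sigma) : Prop :=
  exists mu : cell M -> mem_symbol A, accepts_with mu w.

(* [recR M L] : the language L belongs to the class R(M).                     *)
Definition recR (M : marked_graph) (Sigma : finType) (L : language Sigma)
    : Prop :=
  exists (h : nat) (A : automaton h Sigma),
    0 < h /\ forall w : seq Sigma, L w <-> accepts M A w.

(* The one-letter alphabet {1} is [unit], so 1^n is [nseq n tt].              *)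
Definition omega_of (L : language unit) : omega_word :=
  fun j => odd j || `[< L (nseq j./2 tt) >].

(* Main.v *)
Require Import Defs.
From HB Require Import structures.
From mathcomp Require Import all_boot.
From mathcomp Require Import boolp zify.

(**
  The memory content is a guess: it tags the initial cell with [None] and every
  other cell with [Some b], where [b] claims to be the mark bit of its forward
  edge. The automaton checks that the cell where it starts is tagged [None] and
  from then on rejects whenever a move out of an even cell ends in a cell
  tagged [None]. Since a wrong guess leads back to the initial cell, a run that
  is not rejected has moved forward at every step, whatever the memory content.
  Advancing two cells per letter, the run on [1^n] with [n >= 1] reaches cell
  [2n], follows [+] there, and accepts iff the cell it enters is not tagged
  [None], i.e., iff the edge marked [+] is the forward one.
*)

Inductive walker_state := Start | Check | Probe | Accept | Reject.

Definition walker_state_ord (q : walker_state) : 'I_5 :=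
  inord (match q with
         | Start => 0 | Check => 1 | Probe => 2 | Accept => 3 | Reject => 4
         end).

(** The default [Reject] decodes index 4. *)
Definition walker_state_of_ord (i : 'I_5) : walker_state :=
  nth Reject [:: Start; Check; Probe; Accept] i.

Lemma walker_state_ordK : cancel walker_state_ord walker_state_of_ord.
Proof. by case; rewrite /walker_state_of_ord inordK. Qed.

HB.instance Definition _ := Finite.copy walker_state (can_type walker_state_ordK).

(* In state [Check] the memory is at the even cell [2m] and the head one       *)
(* position past the [m]-th letter, so that the right endmarker is seen        *)
(* exactly when [m] is the length of the input. The empty word never reaches   *)
(* an even cell and its membership [e] is built in.                            *)
Definition walk (e : bool) (q : walker_state) (s : input_symbol unit)
    (a : option bool) : walker_state * head_move * option mark :=
  match q, s, a with
  | Start, LeftEnd, None => (Start, MoveRight, None)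
  | Start, Letter _, _ => (Check, MoveRight, Some Plus)
  | Start, RightEnd, _ => (if e then Accept else Reject, MoveNone, None)
  | Check, Letter _, Some false => (Probe, MoveNone, Some Minus)
  | Check, _, _ => (Probe, MoveNone, Some Plus)
  | Probe, RightEnd, Some _ => (Accept, MoveNone, None)
  | Probe, Letter _, Some _ => (Check, MoveRight, Some Plus)
  | Accept, _, _ => (Accept, MoveNone, None)
  | _, _, _ => (Reject, MoveNone, None)
  end.

Definition walker (e : bool) : automaton 1 unit :=
  {| state := walker_state;
     mem_symbol := option bool;
     delta := fun q s a =>
       let: (q', d, g) := walk e q (s ord0) a in (q', [ffun=> d], g);
     state_init := Start;
     accepting := [set Accept] |}.

Lemma unit_seqE (w : seq unit) : w = nseq (size w) tt.
Proof. by elim: w => //= -[] w <-. Qed.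

Lemma scan_letter (w : seq unit) p : p < size w -> scan w p.+1 = Letter tt.
Proof. by elim: w p => [|[] w IHw] [|p] //= /IHw. Qed.

Lemma scan_right_end (w : seq unit) p : size w = p -> scan w p.+1 = RightEnd.
Proof. by move<-; elim: w. Qed.

Lemma omega_of_odd L k : omega_of L k.*2.+1 = true.
Proof. by rewrite /omega_of /= odd_double. Qed.

Lemma omega_of_even L k : omega_of L k.*2 = `[< L (nseq k tt) >].
Proof. by rewrite /omega_of odd_double doubleK. Qed.

Section Walker.
Variables (L : language unit) (w : seq unit).
Let om := omega_of L.
Let A := walker `[< L [::] >].
Variable mu : cell (W15 om) -> mem_symbol A.

Let cfg (q : walker_state) (p k : nat) : config (W15 om) A :=
  Config (q : state A) [ffun=> p] (k : cell (W15 om)).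

Lemma walker_step q p k :
  step mu w (cfg q p k) =
  let: (q', d, g) := walk `[< L [::] >] q (scan w p) (mu k) in
  cfg q' (move_head w p d) (if g is Some g' then W15_follow om k g' else k).
Proof.
rewrite /step /cfg /= ffunE ffunE.
case: walk => -[q' d] g; congr Config.
by apply/ffunP => i; rewrite !ffunE.
Qed.

(** Made for soundness, with [mu] arbitrary. [InvProbeReturned] is a run thrown back to the initial
    cell, about to be rejected; the implication in [InvProbe] carries the evidence for [L w] to
    acceptance. *)
Inductive walker_inv : config (W15 om) A -> Prop :=
| InvInit : walker_inv (cfg Start 0 0)
| InvStart : mu 0 = None -> walker_inv (cfg Start 1 0)
| InvCheck m : mu 0 = None -> m < size w ->
    walker_inv (cfg Check m.+2 m.*2.+1)
| InvProbeReturned m : mu 0 = None -> walker_inv (cfg Probe m.+2 0)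
| InvProbe m : mu 0 = None -> m < size w -> (m.+1 = size w -> L w) ->
    walker_inv (cfg Probe m.+2 m.*2.+2)
| InvAccept p k : L w -> walker_inv (cfg Accept p k)
| InvReject p k : walker_inv (cfg Reject p k).

Lemma walker_inv_step c : walker_inv c -> walker_inv (step mu w c).
Proof.
case=> [|mu0|m mu0 lt_m|m mu0|m mu0 lt_m Lw|p k Lw|p k]; rewrite walker_step.
- rewrite /=; case mu0: (mu 0) => [b|] /=; first exact: InvReject.
  by rewrite minnSS min0n; apply: InvStart.
- case: (posnP (size w)) => [w0|w_gt0].
    rewrite (scan_right_end _ _ w0) /=; case: asboolP => [L0|_] /=.
      by apply: InvAccept; rewrite (size0nil w0).
    exact: InvReject.
  rewrite (scan_letter _ _ w_gt0) /= minnSS (minn_idPl w_gt0).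
  rewrite /W15_follow /om (omega_of_odd L 0); exact: (InvCheck 0).
- have [lt_m1|ge_m1] := ltnP m.+1 (size w).
    (* A letter remains, so the implication in [InvProbe] is vacuous. *)
    have Lw : m.+1 = size w -> L w by lia.
    rewrite (scan_letter _ _ lt_m1).
    by case: (mu _) => [[]|] /=; rewrite /W15_follow; case: (om _);
      by [apply: InvProbe | apply: InvProbeReturned].
  have ew : size w = m.+1 by lia.
  (* The bit of this even cell is the membership of the whole input, and [Plus] leads forward only
     if it is 1. *)
  rewrite (scan_right_end _ _ ew) /= /W15_follow /om (omega_of_even L m.+1).
  case: asboolP => [Lw|_]; last exact: InvProbeReturned.
  by apply: InvProbe => // _; rewrite (unit_seqE w) ew.
- by rewrite mu0; case: scan => [|?|]; apply: InvReject.
- case: (mu _) => [b|]; last by case: scan => [|?|]; apply: InvReject.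
  have [lt_m1|ge_m1] := ltnP m.+1 (size w).
    rewrite (scan_letter _ _ lt_m1) /= minnSS (minn_idPl lt_m1).
    by rewrite /W15_follow /om (omega_of_odd L m.+1); apply: (InvCheck m.+1).
  have ew : size w = m.+1 by lia.
  by rewrite (scan_right_end _ _ ew); apply: InvAccept; apply: Lw.
- by case: scan (mu k) => [|?|] [?|]; apply: InvAccept.
- by case: scan (mu k) => [|?|] [?|]; apply: InvReject.
Qed.

Lemma walker_sound : accepts_with mu w -> L w.
Proof.
case=> t; have: walker_inv (iter t (step mu w) (config_init _ A)).
  elim: t => [|t IHt]; [exact: InvInit | exact: walker_inv_step].
by case=> [|?|? ? ?|? ?|? ? ? ?|? ? ?|? ?] /set1P.
Qed.

Hypothesis mu0 : mu 0 = None.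
Hypothesis muS : forall k, mu k.+1 = Some (om k.+2).

(** Two steps lead to the first even cell; under truthful tags each further letter takes two
    more. *)
Lemma walker_reaches_check m : m < size w ->
  iter m.*2.+2 (step mu w) (config_init _ A) = cfg Check m.+2 m.*2.+1.
Proof.
elim: m => [|m IHm] lt_m.
  rewrite /= (walker_step Start 0 0) /= mu0 /= minnSS min0n walker_step.
  rewrite (scan_letter _ _ lt_m) /= minnSS (minn_idPl lt_m).
  by rewrite /W15_follow /om (omega_of_odd L 0).
rewrite doubleS 2!iterS IHm 1?ltnW //.
have ->: step mu w (cfg Check m.+2 m.*2.+1) = cfg Probe m.+2 m.*2.+2.
  rewrite walker_step muS (scan_letter _ _ lt_m).
  by case omE: (om m.*2.+2) => /=; rewrite /W15_follow omE.
rewrite walker_step muS (scan_letter _ _ lt_m) /= minnSS (minn_idPl lt_m).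
by rewrite /W15_follow /om (omega_of_odd L m.+1).
Qed.

Lemma walker_complete : L w -> accepts_with mu w.
Proof.
move=> Lw; case ew: (size w) => [|m].
  exists 2; rewrite /= (walker_step Start 0 0) /= mu0 /= minnSS min0n walker_step.
  rewrite (scan_right_end _ _ ew) /=; move: Lw; rewrite (size0nil ew) => /asboolT->.
  by rewrite inE.
have Lm : L (nseq m.+1 tt) by rewrite -ew -unit_seqE.
(* The last two steps follow [Plus] and accept. *)
exists m.*2.+4; rewrite 2!iterS walker_reaches_check ?ew //.
rewrite walker_step (scan_right_end _ _ ew) /= /W15_follow /om.
rewrite (omega_of_even L m.+1) (asboolT Lm) walker_step muS.
by rewrite (scan_right_end _ _ ew) /= inE.
Qed.

End Walker.

Theorem theorem3 (L : language unit) : recR (W15 (omega_of L)) L.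
Proof.
exists 1, (walker `[< L [::] >]); split=> // w; split=> [Lw|[mu]].
  (* Index [k] stands for cell [k.+1], hence the shift in the truthful tag. *)
  exists (fun k => if k is k'.+1 then Some (omega_of L k.+1) else None).
  exact: walker_complete.
exact: walker_sound.
Qed.
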